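(* Let $(X_n)_{n\in\mathbb{N}}$ be a Markov chain on a finite state space $S$ with transition probability matrix $P$ and associated graph $G=(S,E)$. Let $C=\bigcup_\nu C_\nu$ be the union of all maximal communicating classes $C_\nu$ of $G$ and let $D=S\setminus C$. Let $i\in D$. Then the first hitting time $\tau_C=\inf\{n\ge1:X_n\in C\}$ satisfies $\mathbb{P}\{\tau_C<\infty\mid X_0=i\}=1$ and $\mathbb{E}(\tau_C\mid X_0=i)<\infty$.
   Context: Markov chains are time-homogeneous; $p(i,j)$ are the entries of $P$. The associated graph $G=(S,E)$ has $(i,j)\in E$ iff $p(i,j)>0$. Write $i\sim j$ if there are directed paths of length $\ge 1$ in $G$ from $i$ to $j$ and from $j$ to $i$; let $V_c=\{i\in S:i\sim j \text{ for some } j\in S\}$; the communicating classes of $G$ are the sets $[i]=\{j\in S: j\sim i\}$, $i\in V_c$. They are partially ordered by $C_\mu\preceq C_\nu$ iff there is a path in $G$ from some vertex of $C_\mu$ to some vertex of $C_\nu$; ''maximal'' means maximal with respect to $\preceq$. Conditioning on $X_0=i$ means considering the chain started at $i$; $\tau_C=\infty$ if $C$ is never hit. *)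

(* Defs.v *)
From HB Require Import structures.
From mathcomp Require Import all_boot all_order all_algebra.
From mathcomp Require Import all_classical all_reals all_analysis.

Set Implicit Arguments.
Unset Strict Implicit.
Unset Printing Implicit Defensive.

Import Order.TTheory GRing.Theory Num.Theory.

Local Open Scope classical_set_scope.
Local Open Scope ring_scope.

Section Graph.
Context {R : realType} {S : finType}.
Implicit Types (P : S -> S -> R) (i j : S) (C : set S).

Definition stochastic P : Prop :=
  (forall i j, 0 <= P i j) /\ (forall i, \sum_j P i j = 1).

Definition edge P : rel S := fun i j => 0 < P i j.

(* A directed path from i is the list s of the vertices following i; its
   length is size s. *)
Definition dipath P i j : Prop :=
  exists2 s : seq S, path (edge P) i s & last i s = j.

Definition dipath1 P i j : Prop :=
  exists s : seq S, [/\ (1 <= size s)%N, path (edge P) i s & last i s = j].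

Definition communicates P i j : Prop := dipath1 P i j /\ dipath1 P j i.

(* The vertex set V_c; a vertex on no directed cycle belongs to no class. *)
Definition communicating P : set S :=
  [set i | exists j, communicates P i j].

Definition comm_class P : set (set S) :=
  [set C | exists2 i, communicating P i & C = [set j | communicates P j i]].

Definition class_le P C1 C2 : Prop :=
  exists i j, [/\ C1 i, C2 j & dipath P i j].

Definition maximal_class P : set (set S) :=
  [set C | comm_class P C /\
    forall C', comm_class P C' -> class_le P C C' -> C' = C].

Definition maximal_union P : set S := \bigcup_(C in maximal_class P) C.

End Graph.

Section Chain.
Context {d : measure_display} {T : measurableType d} {R : realType}
  {S : finType}.
Implicit Types (Pr : probability T R) (X : nat -> T -> S).

Local Open Scope ereal_scope.

Definition cond_prob Pr (A B : set T) : \bar R := Pr (A `&` B) / Pr B.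

Definition cond_exp Pr (Y : T -> \bar R) (B : set T) : \bar R :=
  (\int[Pr]_(w in B) Y w) / Pr B.

Definition at_state X (n : nat) (s : S) : set T := [set w | X n w = s].

Definition history X (n : nat) (x : nat -> S) : set T :=
  [set w | forall k, (k <= n)%N -> X k w = x k].

(* Time-homogeneous Markov chain with transition matrix P; the initial law is
   arbitrary.  The Markov property is imposed only where the conditional
   probability is meaningful. *)
Definition markov_chain Pr (P : S -> S -> R) X : Prop :=
  [/\ stochastic P,
      forall n s, measurable (at_state X n s) &
      forall n (x : nat -> S) (j : S), 0 < Pr (history X n x) ->
        cond_prob Pr (at_state X n.+1 j) (history X n x) = (P (x n) j)%:E].

(* The infimum is taken in \bar R, so it is +oo when C is never hit. *)
Definition hitting_time X (C : set S) (w : T) : \bar R :=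
  ereal_inf [set n%:R%:E | n in [set n : nat | (1 <= n)%N /\ C (X n w)]].

End Chain.

(* Main.v *)
Require Import Defs.
From mathcomp Require Import all_boot all_order all_algebra.
From mathcomp Require Import all_classical all_reals all_analysis.
From mathcomp Require Import measurable_realfun.
Import Order.TTheory GRing.Theory Num.Theory.
Local Open Scope classical_set_scope.
Local Open Scope ring_scope.

(** From every state a maximal class is reachable in at least one step: follow
    edges to a state whose reachable set is minimal. As [S] is finite, there are
    [N] and [r < 1] such that from every state the probability of avoiding the
    maximal classes at times 1..[N] is at most [r]. Writing [u_m] for the
    probability of avoiding them at times 1..[m], the Markov property gives
    [u_(m+N) <= r u_m], hence [E tau = sum_m P(tau > m) = sum_m u_m] is at most
    [N / (1 - r)]; a variable with finite expectation is almost surely finite. *)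

(** * Maximal classes are reachable from every state *)

Section Reachability.
Set Implicit Arguments.
Unset Strict Implicit.
Context {R : realType} {S : finType}.
Implicit Types (P : S -> S -> R) (i j k : S) (C : set S).

Lemma dipathE P i j : dipath P i j <-> connect (edge P) i j.
Proof.
split=> [[s ps <-]|/connectP[s ps ->]]; last by exists s.
by apply/connectP; exists s.
Qed.

Lemma dipath1E P i j :
  dipath1 P i j <-> exists2 k, edge P i k & connect (edge P) k j.
Proof.
split=> [[[|k s] [//= _ /andP[ik ks] <-]]|[k ik /connectP[s ks ->]]].
  by exists k => //; apply/connectP; exists s.
by exists (k :: s); rewrite /= ik.
Qed.

Lemma dipath1W P i j : dipath1 P i j -> connect (edge P) i j.
Proof.
by move=> /dipath1E[k ik kj]; exact: connect_trans (connect1 ik) kj.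
Qed.

Lemma dipath1_trans P i j k : dipath1 P i j -> connect (edge P) j k ->
  dipath1 P i k.
Proof.
by move=> /dipath1E[l il lj] jk; apply/dipath1E; exists l => //;
  exact: connect_trans lj jk.
Qed.

Lemma communicates_sym P i j : communicates P i j -> communicates P j i.
Proof. by case. Qed.

Lemma communicates_trans P i j k :
  communicates P i j -> communicates P j k -> communicates P i k.
Proof.
move=> [ij ji] [jk kj]; split; first exact: dipath1_trans ij (dipath1W jk).
exact: dipath1_trans kj (dipath1W ji).
Qed.

Lemma stochastic_edge P i : stochastic P -> exists j, edge P i j.
Proof.
move=> [P0 P1]; apply: contrapT => /forallNP noj.
have := P1 i; rewrite big1 => [/eqP|j _]; first by rewrite eq_sym oner_eq0.
by apply/eqP; rewrite eq_le P0 andbT leNgt; apply/negP/noj.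
Qed.

(* A state whose reachable set has least cardinality among the states reachable
   from [i] is reachable from everything it reaches. *)
Lemma connect_sink P i : exists2 j, connect (edge P) i j &
  forall k, connect (edge P) j k -> connect (edge P) k j.
Proof.
pose reach j := [set k | connect (edge P) j k]%SET.
case: (arg_minnP (fun j => #|reach j|) (connect0 (edge P) i)) => j ij jmin.
exists j => // k jk.
have sub : reach k \subset reach j.
  by apply/fintype.subsetP => l; rewrite !inE; exact: connect_trans.
have : reach k == reach j.
  by rewrite eqEcard sub jmin//; exact: connect_trans ij jk.
by move=> /eqP/finset.setP/(_ j); rewrite !inE connect0.
Qed.

(** An edge leaves [j] and its endpoint leads back, so [j] lies on a cycle and has a class. Any
    class above it contains a state reachable from [j], which returns to [j], so the two classes
    coincide. *)
Lemma maximal_union_sink P j : stochastic P ->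
  (forall k, connect (edge P) j k -> connect (edge P) k j) ->
  maximal_union P j.
Proof.
move=> sP sink; have [k jk] := stochastic_edge j sP.
have jj : communicates P j j.
  have : dipath1 P j j.
    by apply/dipath1E; exists k => //; apply: sink; exact: connect1.
  by split.
exists [set l | communicates P l j] => //; split.
  by exists j => //; exists j.
move=> _ [c _ ->] [a] [b] [/= aj bc /dipathE ab].
have jb : connect (edge P) j b by apply: connect_trans ab; case: aj => _ /dipath1W.
have bj : communicates P b j.
  split; first exact: dipath1_trans (dipath1_trans bc.1 (dipath1W bc.2)) (sink _ jb).
  exact: dipath1_trans jj.1 jb.
have cj : communicates P c j.
  exact: communicates_trans (communicates_sym bc) bj.
apply/seteqP; split=> l /= lc; first exact: communicates_trans lc cj.
exact: communicates_trans lc (communicates_sym cj).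
Qed.

Lemma dipath1_maximal_union P i : stochastic P ->
  exists2 j, dipath1 P i j & maximal_union P j.
Proof.
move=> sP; have [k ik] := stochastic_edge i sP.
have [j kj sink] := connect_sink P k.
exists j; first by apply/dipath1E; exists k.
exact: maximal_union_sink.
Qed.

End Reachability.

(** * Geometric decay of the avoidance probabilities *)

Section AvoidanceProbability.
Set Implicit Arguments.
Unset Strict Implicit.
Context {R : realType} {S : finType}.
Implicit Types (P : S -> S -> R) (C : set S).

(** First-step recursion for the probability, starting from [s], of staying outside [C] at times
    1..[m]; the start [s] itself may lie in [C]. *)
Fixpoint avoid_prob P C m s : R :=
  if m is m'.+1 then \sum_(t | t \notin C) P s t * avoid_prob P C m' t else 1.

Lemma avoid_prob_ge0 P C m s : stochastic P -> 0 <= avoid_prob P C m s.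
Proof.
move=> [P0 _]; elim: m s => //= m IH s.
by apply: sumr_ge0 => t _; rewrite mulr_ge0.
Qed.

Lemma avoid_probS_le P C m s : stochastic P ->
  avoid_prob P C m.+1 s <= avoid_prob P C m s.
Proof.
move=> [P0 P1]; elim: m s => [|m IH] s; last first.
  by rewrite /=; apply: ler_sum => t _; apply: ler_wpM2l => //; exact: IH.
rewrite /= -[leRHS](P1 s) big_mkcond; apply: ler_sum => t _.
by case: ifP => _; rewrite ?mulr1.
Qed.

Lemma avoid_prob_nonincreasing P C m n s : stochastic P -> (m <= n)%N ->
  avoid_prob P C n s <= avoid_prob P C m s.
Proof.
move=> sP mn; rewrite -(subnK mn); elim: (n - m)%N => // k IH.
by apply: le_trans IH; rewrite addSn; exact: avoid_probS_le.
Qed.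

Lemma avoid_prob_le1 P C m s : stochastic P -> avoid_prob P C m s <= 1.
Proof. by move=> sP; exact: (avoid_prob_nonincreasing C s sP (leq0n m)). Qed.

(** This carries strictness backwards along an edge: the value below 1 has positive weight in the
    average. *)
Lemma stochastic_mean_lt1 P (v : S -> R) s t : stochastic P ->
  (forall k, v k <= 1) -> edge P s t -> v t < 1 -> \sum_k P s k * v k < 1.
Proof.
move=> [P0 P1] v1 st vt; rewrite -(P1 s) (bigD1 t)//= [ltRHS](bigD1 t)//=.
apply: ltr_leD; first by rewrite gtr_pMr.
by apply: ler_sum => k _; rewrite ler_piMr.
Qed.

Lemma avoid_prob_lt1 P C s t : stochastic P -> dipath1 P s t -> C t ->
  exists m, avoid_prob P C m s < 1.
Proof.
move=> sP [p [p0 sp <-]] Ct; exists (size p).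
elim: p s p0 sp Ct => //= k p IH s _ /andP[sk kp] Ct.
(* Giving the states of [C] the value 0 turns the sum into an average over all of [S]. *)
rewrite big_mkcond (eq_bigr (fun l => P s l *
    (if l \notin C then avoid_prob P C (size p) l else 0))); last first.
  by move=> l _; case: ifP => _; rewrite ?mulr0.
apply: (stochastic_mean_lt1 (t := k)) => //.
  by move=> l; case: ifP => // _; exact: avoid_prob_le1.
case: ifPn => // /negP; rewrite in_setE => Ck.
(* As [k] is outside [C], it is not the end of the path, so the rest is nonempty and the induction
   applies. *)
by case: p kp Ct IH => // l p kp Ct IH; exact: IH.
Qed.

(** [N] is the maximum of the individual times, which suffices because avoidance probabilities
    decrease in time; [r] is the maximum over states at time [N], with default 0. *)
Lemma avoid_prob_uniform P C : stochastic P ->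
  (forall s, exists2 t, dipath1 P s t & C t) ->
  exists (N : nat) (r : R), r < 1 /\ forall s, avoid_prob P C N s <= r.
Proof.
move=> sP hC.
have /choice[f hf] s : exists m, avoid_prob P C m s < 1.
  by have [t st Ct] := hC s; exact: avoid_prob_lt1 st Ct.
exists (\max_s f s), (\big[Order.max/0]_s avoid_prob P C (\max_s f s) s).
split; last by move=> s; exact: le_bigmax.
apply/bigmax_ltP; split=> // s _.
by apply: le_lt_trans (hf s); apply: avoid_prob_nonincreasing => //;
  exact: (leq_bigmax s).
Qed.

Lemma avoid_probD_le P C N r m s : stochastic P ->
  (forall s, avoid_prob P C N s <= r) ->
  avoid_prob P C (m + N) s <= r * avoid_prob P C m s.
Proof.
move=> [P0 _] ur; elim: m s => [|m IH] s /=; first by rewrite mulr1.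
rewrite mulr_sumr; apply: ler_sum => t _.
by rewrite mulrCA ler_wpM2l.
Qed.

Lemma sum_avoid_prob_le P C N r n s : stochastic P -> r < 1 ->
  (forall s, avoid_prob P C N s <= r) ->
  \sum_(0 <= m < n) avoid_prob P C m s <= N%:R / (1 - r).
Proof.
move=> sP r1 ur.
have r0 : 0 <= r by apply: le_trans (ur s); exact: avoid_prob_ge0.
have u0 m : 0 <= avoid_prob P C m s by exact: avoid_prob_ge0.
(* Writing [A] for the partial sum, the claim becomes [A <= N + r * A]: the first [N] terms are at
   most 1 each, and the others are at most [r] times the terms [N] places earlier. *)
rewrite ler_pdivlMr ?subr_gt0// mulrBr mulr1 lerBlDr mulrC.
have [nN|Nn] := leqP n N.
  apply: (@le_trans _ _ N%:R); last by rewrite lerDl mulr_ge0// sumr_ge0.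
  apply: (@le_trans _ _ (\sum_(0 <= m < n) 1)).
    by apply: ler_sum => m _; exact: avoid_prob_le1.
  by rewrite big_const_nat subn0 iter_addr_0 ler_nat.
rewrite [leLHS](big_cat_nat (leq0n N) (ltnW Nn))/=; apply: lerD.
  rewrite -[leRHS](_ : \sum_(0 <= m < N) 1 = _).
    by apply: ler_sum => m _; exact: avoid_prob_le1.
  by rewrite big_const_nat subn0 iter_addr_0.
rewrite -{1}[N]add0n big_addn.
apply: (@le_trans _ _ (\sum_(0 <= m < n - N) r * avoid_prob P C m s)).
  by apply: ler_sum => m _; exact: avoid_probD_le.
rewrite -mulr_sumr ler_wpM2l// [leRHS](big_cat_nat (leq0n _) (leq_subr N n))/=.
by rewrite lerDl sumr_ge0.
Qed.

End AvoidanceProbability.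

(** * Avoidance events of the chain and their probabilities *)

Section Chain.
Set Implicit Arguments.
Unset Strict Implicit.
Context {d : measure_display} {T : measurableType d} {R : realType}
  {S : finType} (Pr : probability T R) (P : S -> S -> R) (X : nat -> T -> S).
Hypothesis hX : markov_chain Pr P X.
Local Open Scope ereal_scope.

Definition avoid (C : set S) (n m : nat) : set T :=
  [set w | forall k, (n < k <= n + m)%N -> ~ C (X k w)].

Let measurable_at n s : measurable (at_state X n s).
Proof. by case: hX. Qed.

Lemma measurable_event n (A : set S) : measurable [set w | A (X n w)].
Proof.
rewrite (_ : mkset _ = \bigcup_(s in A) at_state X n s).
  by apply: fin_bigcup_measurable => //; exact: finite_finset.
by apply/seteqP; split=> [w Aw|w [s As /= ->]//]; exists (X n w).
Qed.

Lemma measurable_history n x : measurable (history X n x).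
Proof.
rewrite (_ : history X n x =
    \bigcap_(k in [set k | (k <= n)%N]) at_state X k (x k)).
  by apply: bigcap_measurableType.
by apply/seteqP; split=> w h k /=; exact: h.
Qed.

Lemma measurable_avoid C n m : measurable (avoid C n m).
Proof.
rewrite (_ : avoid C n m =
    \bigcap_(k in [set k | (n < k <= n + m)%N]) [set w | (~` C) (X k w)]).
  by apply: bigcap_measurableType => k _; exact: measurable_event.
by apply/seteqP; split=> w h k /=; exact: h.
Qed.

Lemma prob_event_partition (E : set T) n (A : set S) : measurable E ->
  Pr (E `&` [set w | A (X n w)]) = \sum_(s | s \in A) Pr (E `&` at_state X n s).
Proof.
move=> mE; have finA : finite_set A := finite_finset.
rewrite (_ : E `&` _ = \bigcup_(s in A) (E `&` at_state X n s)).
  rewrite measure_fin_bigcup//; last 2 first.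
  - by move=> s t _ _ [w [[_ <-] [_ <-]]].
  - by move=> s _; exact: measurableI.
  rewrite [RHS]bigfs ?set_mem_set ?index_enum_uniq// => s _.
  by rewrite mem_index_enum.
apply/seteqP; split=> [w [Ew Aw]|w [s As [Ew /= ws]]].
  by exists (X n w).
by split=> //=; rewrite ws.
Qed.

(** In product form the Markov property also covers null histories, where both sides vanish. *)
Lemma prob_history_step n x j :
  Pr (history X n x `&` at_state X n.+1 j) = Pr (history X n x) * (P (x n) j)%:E.
Proof.
have [h0|] := eqVneq (Pr (history X n x)) 0.
  rewrite h0 mul0e; apply/eqP; rewrite -measure_le0 -h0 le_measure ?inE//.
    by apply: measurableI => //; exact: measurable_history.
  exact: measurable_history.
move=> hn0; have [_ _ /(_ n x j)] := hX.
rewrite lt0e hn0 measure_ge0 => /(_ isT) <-.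
by rewrite /cond_prob muleC -muleA mulVe// ?mule1 ?fin_num_measure// 1?setIC//;
  exact: measurable_history.
Qed.

(** Induction on [m] for all [n] and [x] at once: splitting by the state at time [n.+1] outside [C]
    extends the history by one step, matching the recursion of [avoid_prob]. *)
Lemma prob_history_avoid C n m x :
  Pr (history X n x `&` avoid C n m) =
  Pr (history X n x) * (avoid_prob P C m (x n))%:E.
Proof.
elim: m n x => [|m IH] n x.
  rewrite mule1; congr (Pr _); apply/setIidPl => w _ k; rewrite addn0.
  by move=> /andP[nk kn]; move: (leq_trans nk kn); rewrite ltnn.
rewrite (_ : _ `&` _ =
    (history X n x `&` avoid C n.+1 m) `&` [set w | (~` C) (X n.+1 w)]).
  rewrite prob_event_partition; last first.
    by apply: measurableI; [exact: measurable_history|exact: measurable_avoid].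
  rewrite /= -sumEFin ge0_sume_distrr//.
    apply: eq_big => [t|t _]; first by rewrite in_setC.
    pose y k := if k == n.+1 then t else x k.
    have yn : y n.+1 = t by rewrite /y eqxx.
    have hist : history X n.+1 y = history X n x `&` at_state X n.+1 t.
      apply/seteqP; split=> w.
        move=> h; split=> [k kn|]; last by rewrite -yn; exact: h.
        by rewrite h ?(leq_trans kn)// /y ltn_eqF.
      move=> [h wt] k; rewrite leq_eqVlt => /predU1P[->|kn].
        by rewrite yn.
      by rewrite h// /y ltn_eqF.
    by rewrite setIAC -hist IH yn hist prob_history_step EFinM muleA.
  move=> t _; rewrite lee_fin; case: hX => sP _ _.
  by rewrite mulr_ge0 ?avoid_prob_ge0//; case: sP.
apply/seteqP; split=> w.
  move=> [hw aw]; split; first split=> // k /andP[nk km].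
    by apply: aw; rewrite (ltnW nk) addnS.
  by apply: aw; rewrite ltnSn -addn1 leq_add2l.
move=> [[hw aw] nC]; split=> // k /andP[].
rewrite leq_eqVlt => /predU1P[<- //|nk km].
by apply: aw; rewrite nk addSnnS.
Qed.

(** * The hitting time as a series, and its integral *)

Lemma sum_indic_avoid C n w : (forall m, (m < n)%N -> avoid C 0 m w) ->
  \sum_(0 <= m < n) (\1_(avoid C 0 m) w)%:E = n%:R%:E :> \bar R.
Proof.
move=> aw; rewrite big_mkord (eq_bigr (fun=> 1)) => [|m _].
  by rewrite sumEFin big_const_ord iter_addr_0.
by rewrite indicE mem_set//; exact: aw.
Qed.

(* E[tau] = sum_m P(tau > m), at the level of functions. *)
Lemma hitting_timeE C w :
  hitting_time X C w = \sum_(0 <= m <oo) (\1_(avoid C 0 m) w)%:E :> \bar R.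
Proof.
have ind_ge0 m : 0 <= (\1_(avoid C 0 m) w)%:E :> \bar R by rewrite lee_fin.
apply/eqP; rewrite eq_le; apply/andP; split; last first.
  (* Every partial sum is at most every hitting instant [k]: the terms from index [k] on vanish, and
     the first [k] are at most 1. *)
  apply: lime_le; first exact: is_cvg_nneseries.
  apply: nearW => n; apply: le_ereal_inf_tmp => _ [k [k0 Ck] <-].
  have noavoid m : (k <= m)%N -> ~ avoid C 0 m w.
    by move=> km /(_ k); rewrite k0 add0n => /(_ km).
  (* Enlarging the range to [k + n] allows a cut at [k] without comparing [k] and [n]. *)
  apply: (@le_trans _ _ (\sum_(0 <= m < k + n) (\1_(avoid C 0 m) w)%:E)).
    by rewrite addnC (big_cat_nat (leq0n n) (leq_addr k n))/= leeDl// sume_ge0.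
  rewrite (big_cat_nat (leq0n k) (leq_addr n k))/= [X in _ + X]big_nat_cond.
  rewrite [X in _ + X]big1 ?adde0 => [|m /andP[/andP[km _] _]]; last first.
    by rewrite indicE memNset//; exact: noavoid.
  apply: (@le_trans _ _ (\sum_(0 <= m < k) 1)).
    by apply: lee_sum => m _; rewrite lee_fin indicE lern1 leq_b1.
  by rewrite sumEFin big_const_nat subn0 iter_addr_0.
(* If [C] is never hit, all terms are 1 and the series diverges. Otherwise the least index where
   avoidance fails is a hitting instant. *)
have [all_avoid|/existsNP[m0 nm0]] := pselect (forall m, avoid C 0 m w).
  rewrite (_ : \sum_(_ <= _ <oo) _ = +oo) ?leey//.
  apply/eqyP => r r0.
  apply: (le_trans _ (@nneseries_lim_ge _ _ xpredT 0 (Num.truncn r).+1 _)) => //.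
  by rewrite sum_indic_avoid// lee_fin ltW// truncnS_gt.
have ex : exists m, ~~ `[< avoid C 0 m w >] by exists m0; apply/asboolPn.
(* Index 0 is excluded, since avoidance over an empty range of times always holds. *)
case: (ex_minnP ex) => -[|n] /asboolPn navoid minn.
  by case: navoid => k; rewrite addn0 => /andP[k0 kl]; move: (leq_trans k0 kl).
have before m : (m < n.+1)%N -> avoid C 0 m w.
  move=> mn; apply: contrapT => /asboolPn /minn.
  by rewrite leqNgt mn.
have Cn : C (X n.+1 w).
  apply: contrapT => nC; apply: navoid => k /andP[k0].
  rewrite add0n leq_eqVlt => /predU1P[-> //|kn].
  by apply: (before n) => //; rewrite k0.
apply: (le_trans _ (@nneseries_lim_ge _ _ xpredT 0 n.+1 _)) => //.
by rewrite sum_indic_avoid//; apply: ereal_inf_lbound; exists n.+1.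
Qed.

Lemma hitting_time_ge0 C w : 0 <= hitting_time X C w :> \bar R.
Proof. by rewrite hitting_timeE; apply: nneseries_ge0 => m _ _; rewrite lee_fin. Qed.

Lemma measurable_hitting_time C D :
  measurable_fun D (hitting_time (R := R) X C).
Proof.
rewrite (_ : hitting_time X C =
    fun w => \sum_(m <oo | m \in xpredT) (\1_(avoid C 0 m) w)%:E).
  apply: ge0_emeasurable_sum => [m w _ _|m _]; first by rewrite lee_fin.
  apply/measurable_EFinP/measurable_indic; exact: measurable_avoid.
apply/funext => w; exact: hitting_timeE.
Qed.

(** The series of nonnegative indicators is integrated term by term, and the starting event is a
    history of length zero. *)
Lemma integral_hitting_time C i :
  \int[Pr]_(w in at_state X 0 i) hitting_time X C w =
  \sum_(0 <= m <oo) Pr (at_state X 0 i) * (avoid_prob P C m i)%:E.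
Proof.
under eq_integral do rewrite hitting_timeE.
rewrite integral_nneseries// => [|m]; last first.
  by apply/measurable_EFinP/measurable_indic; exact: measurable_avoid.
apply: eq_eseriesr => m _; rewrite integral_indic//; last exact: measurable_avoid.
have hist : at_state X 0 i = history X 0 (fun=> i).
  apply/seteqP; split=> w /=; last exact.
  by move=> wi k; rewrite leqn0 => /eqP ->.
rewrite setIC hist; exact: (prob_history_avoid C 0 m (fun=> i)).
Qed.

Lemma integral_hitting_time_lty C i :
  (forall s, exists2 t, dipath1 P s t & C t) ->
  \int[Pr]_(w in at_state X 0 i) hitting_time X C w < +oo.
Proof.
move=> hC; have [sP _ _] := hX.
have [N [r [r1 ur]]] := avoid_prob_uniform sP hC.
have p_fin : Pr (at_state X 0 i) \is a fin_num by rewrite fin_num_measure.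
rewrite integral_hitting_time -(fineK p_fin) nneseriesZl//; last first.
  by move=> m _; rewrite lee_fin avoid_prob_ge0.
rewrite fineK// lte_mul_pinfty//.
apply: (@le_lt_trans _ _ (N%:R / (1 - r))%:E); last by rewrite ltry.
apply: lime_le.
  by apply: is_cvg_nneseries => m _ _; rewrite lee_fin avoid_prob_ge0.
apply: nearW => n; rewrite sumEFin lee_fin; exact: sum_avoid_prob_le.
Qed.

Lemma prob_hitting_time_lty C i :
  \int[Pr]_(w in at_state X 0 i) hitting_time X C w < +oo ->
  Pr ([set w | hitting_time (R := R) X C w < +oo] `&` at_state X 0 i) =
  Pr (at_state X 0 i).
Proof.
move=> int_lty; set B := at_state X 0 i.
have mB : measurable B := measurable_at 0 i.
have mh : measurable_fun B (hitting_time (R := R) X C).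
  exact: measurable_hitting_time.
have mBh : measurable (B `&` [set w | hitting_time (R := R) X C w < +oo]).
  exact: emeasurable_fun_infty_o.
have intg : Pr.-integrable B (hitting_time X C).
  apply/integrableP; split=> //.
  by under eq_integral do rewrite gee0_abs ?hitting_time_ge0//.
(* [Z] is a null set containing the points of [B] where the hitting time is infinite, so adding it
   to the finite part covers [B]. *)
have [Z [mZ Z0 BZ]] := integrable_ae mB intg.
rewrite setIC; apply/eqP; rewrite eq_le; apply/andP; split.
  by apply: le_measure; rewrite ?inE.
rewrite -[leRHS]adde0 -Z0; apply: le_trans (measureU2 _ _ _) => //.
apply: le_measure; rewrite ?inE//; first exact: measurableU.
move=> w Bw; have [fin|ninf] := pselect (hitting_time (R := R) X C w < +oo).
  by left.
right; apply: BZ => /(_ Bw); rewrite fin_numElt => /andP[_ ltoo].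
exact: ninf.
Qed.

End Chain.

Local Open Scope ereal_scope.

Theorem fact16 (d : measure_display) (T : measurableType d) (R : realType)
    (Pr : probability T R) (S : finType) (P : S -> S -> R) (X : nat -> T -> S)
    (hX : markov_chain Pr P X) (i : S) (hi : (~` maximal_union P) i)
    (hi0 : 0 < Pr (at_state X 0%N i)) :
  cond_prob Pr [set w | hitting_time (R := R) X (maximal_union P) w < +oo]
    (at_state X 0%N i) = 1 /\
  cond_exp Pr (hitting_time X (maximal_union P)) (at_state X 0%N i) < +oo.
Proof.
have [sP mX _] := hX.
have p_fin : Pr (at_state X 0%N i) \is a fin_num by rewrite fin_num_measure.
have p_neq0 : Pr (at_state X 0%N i) != 0 by rewrite gt_eqF.
have int_lty := integral_hitting_time_lty hX i
  (fun s => dipath1_maximal_union s sP).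
split; first by rewrite /cond_prob (prob_hitting_time_lty hX)// muleC mulVe.
rewrite /cond_exp muleC; apply: lte_mul_pinfty => //; first by rewrite inve_ge0.
by move: p_fin; rewrite fin_numE => /andP[pNy _]; exact: fin_numV.
Qed.
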